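(* The recursive algorithm described in the context solves QDSO and AUX over trees in polynomial time. That is, for every input consisting of a rooted tree $T=(V,F)$ with root $r$ and a real number $a>2$, the subgraphs $G^*_r,G^+_r\subseteq T$ output by the algorithm are optimal for QDSO over $T$ and for AUX over $T$, respectively, and the algorithm can be run in time polynomial in $|V|$.
   Context: A subgraph $G\subseteq T$ of a graph $T=(V,F)$ always means a graph $G=(V,E)$ with the same vertex set $V$ and $E\subseteq F$; $d_v(G)$ is the degree of $v$ in $G$. Let $T=(V,F)$ be a tree with root $r\in V$, and let $f(x):=x(x-a)$ with $a\in\mathbb{R}$, $a>2$. For each $v\in V$, $D_v$ is the set of descendants of $v$ (including $v$), $C_v\subset D_v$ is the set of children of $v$ (excluding $v$), and $T_v=(D_v,F_v)$ is the subtree of $T$ rooted at $v$. For a rooted tree $T$ with root $r$ and a subgraph $G\subseteq T$ let $$f(G):=\sum_{v\in V}f(d_v(G)),\qquad g(G):=f(d_r(G)+1)+\sum_{v\in V\setminus\{r\}}f(d_v(G)).$$ QDSO over $T$ is the problem $\max\{f(G):G\subseteq T\}$; AUX over $T$ is the problem $\max\{g(G):G\subseteq T\}$. (For the subtree $T_v$ the same definitions are used with root $v$.) The union of graphs $G_i=(V_i,E_i)$, $i=1,2$, is $G_1\cup G_2:=(V_1\cup V_2,E_1\cup E_2)$. Algorithm for QDSO and AUX over trees: 1. Input: a tree $T=(V,F)$ rooted at $r\in V$, and a real number $a>2$. 2. For each $v\in C_r$, apply the algorithm recursively to the subtree $T_v=(D_v,F_v)$ rooted at $v$ and the number $a$,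 and obtain $G^*_v,G^+_v$ and $f(G^*_v),g(G^+_v)$. 3. Find $$C^*\in\arg\max\{f(C):C\subseteq C_r,\ |C|<a-1\ \text{or}\ C=C_r\},\qquad C^+\in\arg\max\{g(C):C\subseteq C_r,\ |C|<a-1\ \text{or}\ C=C_r\},$$ where for each $C\subseteq C_r$, $$f(C):=|C|(|C|-a)+\sum_{v\in C}g(G^+_v)+\sum_{v\in C_r\setminus C}f(G^*_v),\qquad g(C):=f(C)+2|C|+1-a,$$ $$G(C):=\big(\{r\}\cup C,\{\{r,v\}:v\in C\}\big)\cup\bigcup\{G^+_v:v\in C\}\cup\bigcup\{G^*_v:v\in C_r\setminus C\}.$$ 4. Output: $G^*_r:=G(C^* )$, $G^+_r:=G(C^+)$ and $f(G^*_r),g(G^+_r)$. Step 3 does not prescribe the method by which the maximizers $C^*,C^+$ are found. *)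

(* Defs.v *)
From mathcomp Require Import all_boot all_order all_algebra.
From mathcomp Require Import boolp reals.

Set Implicit Arguments.
Unset Strict Implicit.
Unset Printing Implicit Defensive.

Import Order.TTheory GRing.Theory Num.Theory.
Local Open Scope ring_scope.

(* The vertices of a graph form a subset of an ambient finite type [U], so that
   a graph, its subtrees and their unions all live in the same type. *)
Record graph (U : finType) := Graph {
  vset : {set U};
  eset : {set {set U}}
}.

Section Graphs.
Variable U : finType.
Implicit Types (G H T : graph U) (r v w : U).

Definition simple_graph G : Prop :=
  forall e, e \in eset G -> e \subset vset G /\ #|e| = 2%N.

Definition adj G : rel U := fun v w => [set v; w] \in eset G.

Definition degree G v : nat := #|[set e in eset G | v \in e]|.

Definition spanning_subgraph G T : Prop :=
  vset G = vset T /\ eset G \subset eset T.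

Definition gempty : graph U := Graph set0 set0.

Definition gunion G H : graph U :=
  Graph (vset G :|: vset H) (eset G :|: eset H).

Definition connected_graph G : Prop :=
  {in vset G &, forall v w, connect (adj G) v w}.

(* A closed walk [v; w; v] along one edge is a [ucycle] of size 2. *)
Definition acyclic_graph G : Prop :=
  forall c : seq U, ucycle (adj G) c -> (size c <= 2)%N.

Definition rooted_tree T r : Prop :=
  [/\ simple_graph T, r \in vset T, connected_graph T & acyclic_graph T].

(* [w] descends from [v] iff [v] lies on the path from the root [r] to [w]. *)
Definition descendants T r v : {set U} :=
  [set w in vset T |
    `[< exists p : seq U,
          [/\ path (adj T) r p, uniq (r :: p), last r p = w
            & v \in r :: p] >]].

Definition children T r v : {set U} :=
  [set w in descendants T r v | adj T v w].

Definition subtree T r v : graph U :=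
  Graph (descendants T r v)
        [set e in eset T | e \subset descendants T r v].

End Graphs.

Arguments gempty {U}.

Section Algorithm.
Variables (R : realType) (U : finType).
Variable a : R.
Implicit Types (G T : graph U) (r v : U) (C : {set U}) (Gs Gp : U -> graph U).

Definition quad (x : R) : R := x * (x - a).

Definition qdso_obj G : R := \sum_(v in vset G) quad (degree G v)%:R.

Definition aux_obj r G : R :=
  quad ((degree G r)%:R + 1) + \sum_(v in vset G :\ r) quad (degree G v)%:R.

Definition is_maximizer (A : Type) (P : A -> Prop) (obj : A -> R) (x : A) :=
  P x /\ forall y, P y -> obj y <= obj x.

Definition solves_QDSO T G : Prop :=
  is_maximizer (fun H => spanning_subgraph H T) qdso_obj G.

Definition solves_AUX T r G : Prop :=
  is_maximizer (fun H => spanning_subgraph H T) (aux_obj r) G.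

(* In the following, [Gs v] and [Gp v] stand for G*_v and G+_v. *)

Definition candidate T r C : Prop :=
  C \subset children T r r /\ (#|C|%:R < a - 1 \/ C = children T r r).

Definition set_f T r Gs Gp C : R :=
  #|C|%:R * (#|C|%:R - a) + \sum_(v in C) aux_obj v (Gp v)
  + \sum_(v in children T r r :\: C) qdso_obj (Gs v).

Definition set_g T r Gs Gp C : R :=
  set_f T r Gs Gp C + 2 * #|C|%:R + 1 - a.

Definition assemble T r Gs Gp C : graph U :=
  gunion (Graph (r |: C) [set [set r; v] | v in C])
    (gunion (\big[@gunion U/gempty]_(v in C) Gp v)
            (\big[@gunion U/gempty]_(v in children T r r :\: C) Gs v)).

(* [alg_run T r G H]: the algorithm, on the tree [T] rooted at [r] and the
   number [a], may output G*_r = G and G+_r = H.  It is a relation because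
   the two maximizers need not be unique. *)
Inductive alg_run : graph U -> U -> graph U -> graph U -> Prop :=
| AlgRun T r Gs Gp Cs Cp :
    (forall v, v \in children T r r ->
       alg_run (subtree T r v) v (Gs v) (Gp v)) ->
    is_maximizer (candidate T r) (set_f T r Gs Gp) Cs ->
    is_maximizer (candidate T r) (set_g T r Gs Gp) Cp ->
    alg_run T r (assemble T r Gs Gp Cs) (assemble T r Gs Gp Cp).

End Algorithm.

(* Since the input contains an arbitrary real number, running time is measured
   in a unit-cost model with exact real arithmetic, as for the real RAM or the
   Blum-Shub-Smale machine.  Programs are written in a first-order functional
   language on binary trees (in the style of the language F of N. D. Jones,
   Computability and Complexity, 1997), whose leaves are nil, vertex names or
   real numbers.  The only operations are pairing and projections, equality of
   names, ring operations on and comparison of numbers, and calls of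
   (mutually recursive) functions, each of which costs one step.  There is
   neither division nor rounding.  The syntax mentions no vertex name and no
   number other than natural constants, so a program is a finite object that
   cannot depend on the input. *)

Inductive arith := Add | Sub | Mul.

Inductive expr :=
| EVar of nat                          (* de Bruijn index *)
| ENil
| ENum of nat
| EPair of expr & expr
| EFst of expr
| ESnd of expr
| EArith of arith & expr & expr
| ELet of expr & expr                  (* binds index 0 in the second one *)
| EIfPair of expr & expr & expr        (* is it a pair? *)
| EIfEq of expr & expr & expr & expr   (* are the two names equal? *)
| EIfLe of expr & expr & expr & expr   (* first number <= second number? *)
| ECall of nat & expr.

(* The bodies of the functions 0, 1, ...; each function has one argument,
   which is index 0 in its body.  Function 0 is the main function. *)
Definition program := seq expr.

Inductive value (R : Type) (U : Type) :=
| VNil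
| VName of U
| VNum of R
| VPair of value R U & value R U.

Arguments VNil {R U}.
Arguments VName {R U}.
Arguments VNum {R U}.

Section Semantics.
Variables (R : realType) (U : finType).
Implicit Types (s : seq (value R U)) (u v w : value R U) (t : nat).

Definition is_pair v : bool := if v is VPair _ _ then true else false.

Definition arith_op (o : arith) (x y : R) : R :=
  match o with Add => x + y | Sub => x - y | Mul => x * y end.

Local Open Scope nat_scope.

(* [eval P s e v t]: with the functions of [P] and in the environment [s], the
   expression [e] evaluates to [v] in exactly [t] steps.  An ill-typed
   operation has no value. *)
Inductive eval (P : program) :
    seq (value R U) -> expr -> value R U -> nat -> Prop :=
| EvVar s i v :
    onth s i = Some v -> eval P s (EVar i) v 1
| EvNil s :
    eval P s ENil VNil 1
| EvNum s n :
    eval P s (ENum n) (VNum n%:R%R) 1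
| EvPair s e1 e2 v1 v2 t1 t2 :
    eval P s e1 v1 t1 -> eval P s e2 v2 t2 ->
    eval P s (EPair e1 e2) (VPair v1 v2) (t1 + t2).+1
| EvFst s e v1 v2 t :
    eval P s e (VPair v1 v2) t -> eval P s (EFst e) v1 t.+1
| EvSnd s e v1 v2 t :
    eval P s e (VPair v1 v2) t -> eval P s (ESnd e) v2 t.+1
| EvArith s o e1 e2 x y t1 t2 :
    eval P s e1 (VNum x) t1 -> eval P s e2 (VNum y) t2 ->
    eval P s (EArith o e1 e2) (VNum (arith_op o x y)) (t1 + t2).+1
| EvLet s e1 e2 v1 v2 t1 t2 :
    eval P s e1 v1 t1 -> eval P (v1 :: s) e2 v2 t2 ->
    eval P s (ELet e1 e2) v2 (t1 + t2).+1
| EvIfPair s e e1 e2 u v t1 t2 :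
    eval P s e u t1 ->
    eval P s (if is_pair u then e1 else e2) v t2 ->
    eval P s (EIfPair e e1 e2) v (t1 + t2).+1
| EvIfEq s e1 e2 e3 e4 (x y : U) v t1 t2 t3 :
    eval P s e1 (VName x) t1 -> eval P s e2 (VName y) t2 ->
    eval P s (if x == y then e3 else e4) v t3 ->
    eval P s (EIfEq e1 e2 e3 e4) v (t1 + t2 + t3).+1
| EvIfLe s e1 e2 e3 e4 (x y : R) v t1 t2 t3 :
    eval P s e1 (VNum x) t1 -> eval P s e2 (VNum y) t2 ->
    eval P s (if (x <= y)%R then e3 else e4) v t3 ->
    eval P s (EIfLe e1 e2 e3 e4) v (t1 + t2 + t3).+1
| EvCall s f e u v t1 t2 :
    eval P s e u t1 -> eval P [:: u] (nth ENil P f) v t2 ->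
    eval P s (ECall f e) v (t1 + t2).+1.

(* So existence of an evaluation expresses termination with that result. *)
Lemma eval_deterministic P s e v t v' t' :
  eval P s e v t -> eval P s e v' t' -> v' = v /\ t' = t.
Proof.
move=> ev; elim: ev v' t'.
- by move=> {}s i {}v sv v' t' ev'; inversion ev'; split; congruence.
- by move=> {}s v' t' ev'; inversion ev'.
- by move=> {}s n v' t' ev'; inversion ev'.
- move=> {}s e1 e2 v1 v2 t1 t2 _ IH1 _ IH2 v' t' ev'; inversion ev'; subst.
  have [-> ->] := IH1 _ _ ltac:(eassumption).
  by have [-> ->] := IH2 _ _ ltac:(eassumption).
- move=> {}s {}e v1 v2 {}t _ IH v' t' ev'; inversion ev'; subst.
  by have [[-> _] ->] := IH _ _ ltac:(eassumption).
- move=> {}s {}e v1 v2 {}t _ IH v' t' ev'; inversion ev'; subst.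
  by have [[_ ->] ->] := IH _ _ ltac:(eassumption).
- move=> {}s o e1 e2 x y t1 t2 _ IH1 _ IH2 v' t' ev'; inversion ev'; subst.
  have [[->] ->] := IH1 _ _ ltac:(eassumption).
  by have [[->] ->] := IH2 _ _ ltac:(eassumption).
- move=> {}s e1 e2 v1 v2 t1 t2 _ IH1 _ IH2 v' t' ev'; inversion ev'; subst.
  have [E ->] := IH1 _ _ ltac:(eassumption); subst.
  by have [-> ->] := IH2 _ _ ltac:(eassumption).
- move=> {}s e0 e1 e2 u {}v t1 t2 _ IH1 _ IH2 v' t' ev'; inversion ev'; subst.
  have [E ->] := IH1 _ _ ltac:(eassumption); subst.
  by have [-> ->] := IH2 _ _ ltac:(eassumption).
- move=> {}s e1 e2 e3 e4 x y {}v t1 t2 t3 _ IH1 _ IH2 _ IH3 v' t' ev'.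
  inversion ev'; subst.
  have [[E1] ->] := IH1 _ _ ltac:(eassumption).
  have [[E2] ->] := IH2 _ _ ltac:(eassumption); subst.
  by have [-> ->] := IH3 _ _ ltac:(eassumption).
- move=> {}s e1 e2 e3 e4 x y {}v t1 t2 t3 _ IH1 _ IH2 _ IH3 v' t' ev'.
  inversion ev'; subst.
  have [[E1] ->] := IH1 _ _ ltac:(eassumption).
  have [[E2] ->] := IH2 _ _ ltac:(eassumption); subst.
  by have [-> ->] := IH3 _ _ ltac:(eassumption).
- move=> {}s f {}e u {}v t1 t2 _ IH1 _ IH2 v' t' ev'; inversion ev'; subst.
  have [E ->] := IH1 _ _ ltac:(eassumption); subst.
  by have [-> ->] := IH2 _ _ ltac:(eassumption).
Qed.

Definition runs_to (P : program) (input output : value R U) (t : nat) : Prop :=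
  eval P [:: input] (nth ENil P 0) output t.

Definition vlist (l : seq (value R U)) : value R U :=
  foldr (@VPair R U) VNil l.

(* A graph is written as the list of its vertices and the list of its edges,
   without repetitions but in any order; either orientation of an edge may be
   used. *)
Definition encodes (d : value R U) (G : graph U) : Prop :=
  exists (vs : seq U) (es : seq (U * U)),
    let edges := [seq [set e.1; e.2] | e <- es] in
    [/\ uniq vs /\ vs =i vset G,
        uniq edges /\ edges =i eset G
      & d = VPair (vlist [seq VName x | x <- vs])
                  (vlist [seq VPair (VName e.1) (VName e.2) | e <- es])].

(* On every encoding of the input (T, r, a), the program halts within [bound]
   steps and returns G*_r, G+_r, f(G*_r), g(G+_r) for some run of the
   algorithm. *)
Definition executes_within (P : program) (bound : nat)
    (T : graph U) (r : U) (a : R) : Prop :=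
  forall dT, encodes dT T ->
  exists (Gs Gp : graph U) (dGs dGp : value R U) (t : nat),
    [/\ runs_to P
          (VPair dT (VPair (VName r) (VNum a)))
          (VPair (VPair dGs dGp)
                 (VPair (VNum (qdso_obj a Gs)) (VNum (aux_obj a r Gp)))) t,
        t <= bound,
        encodes dGs Gs, encodes dGp Gp
      & alg_run a T r Gs Gp].

End Semantics.

(* Main.v *)
Require Import Defs.
From mathcomp Require Import all_boot all_order all_algebra.
From mathcomp Require Import boolp reals.
From mathcomp Require Import zify ring lra.

Set Implicit Arguments.
Unset Strict Implicit.
Unset Printing Implicit Defensive.

Import Order.TTheory GRing.Theory Num.Theory.
Local Open Scope ring_scope.

(** Removing the root [r] of a tree leaves one component per child [v], namely
    the subtree of descendants of [v].  Hence a subgraph [H] of the tree is the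
    same thing as a set [C] of children joined to [r], together with one
    subgraph of each child's subtree.  The edge from [r] to [v] raises the
    degree of [v] by one, and this is exactly what the objective of AUX
    accounts for.  So the objective of [H] is [|C| (|C| - a)] (with [|C| + 1]
    in place of [|C|] for AUX) plus AUX objectives below the children in [C]
    and QDSO objectives below the others ([shifted_obj_decomp]), and for a
    fixed [C] optimal subgraphs below the children are optimal.

    It remains to see why only the sets [C] with [|C| < a - 1] and the set of
    all children have to be compared ([candidates_suffice]).  Joining a child to
    [r] changes the objective below it by at least [1 - a], since
    [f (d + 1) - f d = 2 d + 1 - a].  If [|C| >= a - 1], joining all [k]
    remaining children changes the term of the root by
    [k (2 |C| + k - a) >= k (a - 1)], which makes up for this loss.  Optimality
    of every output ([alg_run_optimal]) follows by induction on the run.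

    For the running time, a maximizer [C] of each size is found greedily: the
    sum to maximize is, for a fixed size, a constant plus the sum over [C] of
    the gains [aux_obj (Gp v) - qdso_obj (Gs v)], so the best set of size [j]
    consists of the [j] children with the largest gains ([sorted_take_max]).
    The program sorts the children by gain and compares the prefixes of
    admissible size ([best_calls]).  It never computes a subtree: to recurse it
    only removes the edges at the root from its list of edges.  What remains has
    the edges of all the children's subtrees, but those that meet the subtree of
    one child are exactly the edges of that subtree ([lists_edges],
    [split_rest]).  The work at one vertex is then cubic in the
    number of edges, and the recursion visits each vertex once
    ([solve_calls]). *)

(** * Rooted trees *)

Section Trees.
Variable U : finType.
Implicit Types (G H T : graph U) (r v w x y : U) (e : {set U}).

Lemma set2_inj x : injective (fun y => [set x; y]).
Proof.
move=> y z eq_xyz; have := set22 x y; rewrite eq_xyz !inE => /pred2P[|//] yx.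
by have := set22 x z; rewrite -eq_xyz yx !inE orbb => /eqP.
Qed.

Lemma adj_sym G : symmetric (adj G).
Proof. by move=> v w; rewrite /adj setUC. Qed.

Lemma adj_vset G v w :
  simple_graph G -> adj G v w -> [/\ v \in vset G, w \in vset G & v != w].
Proof.
move=> sG /sG[/subsetP sub card2]; split; rewrite ?sub ?set21 ?set22 //.
by apply/eqP => vw; rewrite vw setUid cards1 in card2.
Qed.

Lemma edge_at G x e :
  simple_graph G -> e \in eset G -> x \in e ->
  exists2 y, e = [set x; y] & adj G x y.
Proof.
move=> sG eG xe; have [_ /eqP/cards2P[u [w [_ def_e]]]] := sG _ eG.
move: xe; rewrite def_e !inE => /pred2P[]->; [exists w | exists u] => //.
- by rewrite /adj -def_e.
- by rewrite setUC.
- by rewrite adj_sym /adj -def_e.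
Qed.

Section RootedTree.
Variables (T : graph U) (r : U).
Hypothesis treeT : rooted_tree T r.

Let simpleT : simple_graph T. Proof. by case: treeT. Qed.
Let root_in : r \in vset T. Proof. by case: treeT. Qed.

Definition adj_off_root : rel U :=
  fun x y => [&& adj T x y, x != r & y != r].

Let adj_off_root_sym : symmetric adj_off_root.
Proof. by move=> x y; rewrite /adj_off_root adj_sym [(x != r) && _]andbC. Qed.

Lemma off_root_path v p : v != r ->
  path adj_off_root v p = path (adj T) v p && (r \notin p).
Proof.
elim: p v => //= w p IH v vr; rewrite inE negb_or eq_sym /adj_off_root vr /=.
by case: (eqVneq w r) => [|wr] /=; rewrite ?andbF ?andbT // IH // andbA.
Qed.

(** A simple path from [r] that starts with the edge to [v] never returns to
    [r]; conversely such a path from [v] extends to [r].  So the descendants of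
    a child form a component of the tree minus its root. *)
Lemma mem_descendants v w : adj T r v ->
  (w \in descendants T r v) = connect adj_off_root v w.
Proof.
move=> rv; have [_ vV] := adj_vset simpleT rv; rewrite eq_sym => vr.
apply/idP/idP.
  rewrite inE => /andP[_ /asboolP[p [pp up <-]]]; rewrite inE (negPf vr) /=.
  move=> vp; case/splitPr: vp pp up => p1 p2.
  rewrite cat_path /= last_cat mem_cat inE !negb_or.
  case/and3P=> _ _ pp2 /andP[/and3P[_ _ rp2] _].
  by apply/connectP; exists p2; rewrite // off_root_path ?pp2.
case/connectP=> p /shortenP[q]; rewrite off_root_path // => /andP[pq rq] uq _ ->.
rewrite inE; apply/andP; split; last first.
  apply/asboolP; exists (v :: q); split=> //=; last by rewrite !inE eqxx orbT.
    by rewrite rv.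
  by move: uq => /= ->; rewrite inE eq_sym (negPf vr) rq.
case/lastP: q pq {rq uq} => [|q x] //=; rewrite rcons_path last_rcons.
by case/andP=> _ /(adj_vset simpleT)[].
Qed.

Lemma descendants_root : descendants T r r = vset T.
Proof.
apply/setP=> w; rewrite inE andb_idr // => wV; apply/asboolP.
have [_ _ conT _] := treeT.
have /connectP[p /shortenP[q pq uq _ ->]] := conT _ _ root_in wV.
by exists q; rewrite mem_head.
Qed.

Lemma mem_children v : (v \in children T r r) = adj T r v.
Proof.
by rewrite inE descendants_root andb_idl // => /(adj_vset simpleT)[].
Qed.

Lemma child_descendant v : v \in children T r r -> v \in descendants T r v.
Proof. by rewrite mem_children => rv; rewrite mem_descendants. Qed.

Lemma root_notin_descendants v :
  v \in children T r r -> r \notin descendants T r v.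
Proof.
rewrite mem_children => rv; rewrite mem_descendants //.
apply/connectP=> -[p]; have [_ _ vr] := adj_vset simpleT rv.
rewrite off_root_path 1?eq_sym // => /andP[_ rp] rl.
by have := mem_last v p; rewrite -rl inE (negPf vr) (negPf rp).
Qed.

Lemma descendants_vset v : descendants T r v \subset vset T.
Proof. by apply/subsetP=> w; rewrite inE => /andP[]. Qed.

Lemma descendants_cover w : w \in vset T -> w != r ->
  exists2 v, v \in children T r r & w \in descendants T r v.
Proof.
move=> wV wr; have [_ _ conT _] := treeT.
have /connectP[p /shortenP[q pq uq _ def_w]] := conT _ _ root_in wV.
case: q pq uq def_w => [|v q] /=; first by move=> _ _ /eqP; rewrite (negPf wr).
case/andP=> rv pq; rewrite inE negb_or => /andP[/andP[rv' rq] _] def_w.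
exists v; first by rewrite mem_children.
rewrite mem_descendants //; apply/connectP; exists q => //.
by rewrite off_root_path ?pq // eq_sym.
Qed.

(** By acyclicity: a path off the root between two different children would
    close up to a cycle through [r]. *)
Lemma descendants_disjoint v1 v2 w :
  v1 \in children T r r -> v2 \in children T r r ->
  w \in descendants T r v1 -> w \in descendants T r v2 -> v1 = v2.
Proof.
rewrite !mem_children => rv1 rv2; rewrite !mem_descendants //.
move=> c1; rewrite (sym_connect_sym adj_off_root_sym) => c2.
have [_ _ _ acyT] := treeT; apply/eqP/idPn => nv12.
have [_ _ v1r] := adj_vset simpleT rv1.
have /connectP[p /shortenP[q + uq _ def_v2]] := connect_trans c1 c2.
rewrite off_root_path 1?eq_sym // => /andP[pq rq].
have /acyT : ucycle (adj T) (r :: v1 :: q).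
  rewrite /ucycle /= rcons_path rv1 pq -def_v2 adj_sym rv2 /=.
  by rewrite inE (negPf v1r) rq.
by case: q def_v2 {uq pq rq} => [/eqP|//]; rewrite eq_sym (negPf nv12).
Qed.

Lemma edge_descendants v x y : v \in children T r r -> adj T x y -> y != r ->
  x \in descendants T r v -> y \in descendants T r v.
Proof.
move=> vC xy yr xD; have xr: x != r.
  by apply: contraTneq xD => ->; apply: root_notin_descendants.
move: vC xD; rewrite mem_children => rv; rewrite !mem_descendants // => vx.
by apply: connect_trans vx (connect1 _); apply/and3P.
Qed.

Lemma edge_sub_descendants v e : v \in children T r r -> e \in eset T ->
  r \notin e -> ~~ [disjoint e & descendants T r v] ->
  e \subset descendants T r v.
Proof.
move=> vC eT re /pred0Pn[x /andP[xe xD]].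
have [y def_e xy] := edge_at simpleT eT xe.
apply/subsetP=> z; rewrite def_e => /set2P[]-> //.
apply: (edge_descendants vC xy _ xD).
by apply: contraNneq re => <-; rewrite def_e set22.
Qed.

Lemma subtree_rooted v :
  v \in children T r r -> rooted_tree (subtree T r v) v.
Proof.
move=> vC; have vD := child_descendant vC.
have rD := root_notin_descendants vC.
have sub_adj : subrel (adj (subtree T r v)) (adj T).
  by move=> x y; rewrite /adj /= inE => /andP[].
split=> //.
- move=> e; rewrite inE => /andP[eT eD]; split=> //.
  by have [] := simpleT eT.
- suff con w : w \in descendants T r v -> connect (adj (subtree T r v)) v w.
    move=> x y xD yD; apply: connect_trans (con y yD).
    by rewrite (sym_connect_sym (@adj_sym _)) con.
  move=> wD; have := wD; rewrite mem_descendants -?mem_children //.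
  case/connectP=> p pp ->{wD w}; apply/connectP; exists p => //.
  suff walk x : x \in descendants T r v ->
    path adj_off_root x p -> path (adj (subtree T r v)) x p by exact: walk.
  elim: p x {pp} => //= y p IH x xD /andP[xy pp].
  have /and3P[xyT xr yr] := xy.
  have yD := edge_descendants vC xyT yr xD; rewrite IH // andbT.
  rewrite /adj inE [_ \in eset T]xyT; apply/subsetP => z.
  by case/set2P=> ->.
- have [_ _ _ acyT] := treeT => c; rewrite /ucycle => /andP[cc uc].
  by apply: acyT; rewrite /ucycle uc andbT; apply: sub_cycle cc.
Qed.

Lemma card_subtree v : v \in children T r r ->
  (#|vset (subtree T r v)| < #|vset T|)%N.
Proof.
move=> vC; apply/proper_card/properP; split; first exact: descendants_vset.
by exists r => //; apply: root_notin_descendants.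
Qed.

Lemma vset_partition (V : nmodType) (F : U -> V) :
  \sum_(w in vset T :\ r) F w
  = \sum_(v in children T r r) \sum_(w in descendants T r v) F w.
Proof.
pose D v := if v \in children T r r then descendants T r v else set0.
have -> : vset T :\ r = \bigcup_v D v.
  apply/setP=> w; rewrite !inE; apply/andP/bigcupP => [[wr wV]|[v _]].
    by have [v vC wD] := descendants_cover wV wr; exists v; rewrite // /D vC.
  rewrite /D; case: ifPn => [vC wD|_]; last by rewrite inE.
  split; last exact: (subsetP (descendants_vset v)).
  by apply: contraTneq wD => ->; apply: root_notin_descendants.
rewrite partition_disjoint_bigcup => [|v1 v2 nv12].
  rewrite [RHS]big_mkcond; apply: eq_bigr => v _.
  by rewrite /D; case: ifP; rewrite // big_set0.
apply/pred0P => w /=; apply: contraNF nv12 => /andP[]; rewrite /D.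
case: ifP => [v1C|_]; last by rewrite in_set0.
case: ifP => [v2C|_]; last by rewrite in_set0.
by move=> w1 w2; rewrite (descendants_disjoint v1C v2C w1 w2).
Qed.

Lemma card_vset :
  #|vset T| = (\sum_(v in children T r r) #|vset (subtree T r v)|).+1.
Proof.
rewrite (cardsD1 r) root_in -sum1_card (@vset_partition nat) //.
by congr _.+1; apply: eq_bigr => v _; rewrite sum1_card.
Qed.

End RootedTree.
End Trees.

(** * Decomposition of the objectives at the root *)

Section Objectives.
Variables (R : realType) (U : finType) (a : R).
Implicit Types (G H T : graph U) (r v w : U) (C : {set U}) (d : R).
Implicit Types (Gs Gp : U -> graph U).

(** Both objectives are instances, [d = 0] giving QDSO and [d = 1] giving AUX, so
    that they can be treated together. *)
Definition shifted_obj d r G : R :=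
  quad a ((degree G r)%:R + d)
  + \sum_(v in vset G :\ r) quad a (degree G v)%:R.

Lemma qdso_objE r G : r \in vset G -> qdso_obj a G = shifted_obj 0 r G.
Proof. by move=> rG; rewrite /qdso_obj (big_setD1 r rG) /shifted_obj addr0. Qed.

Lemma aux_qdso_obj r G : r \in vset G ->
  aux_obj a r G = qdso_obj a G + 2 * (degree G r)%:R + 1 - a.
Proof.
by move=> rG; rewrite (qdso_objE rG) /aux_obj /shifted_obj /quad; ring.
Qed.

(** The corresponding common form of [set_f] and [set_g]. *)
Definition set_obj T r d Gs Gp C : R :=
  quad a (#|C|%:R + d) + \sum_(v in C) aux_obj a v (Gp v)
  + \sum_(v in children T r r :\: C) qdso_obj a (Gs v).

Lemma set_fE T r Gs Gp C : set_f a T r Gs Gp C = set_obj T r 0 Gs Gp C.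
Proof. by rewrite /set_f /set_obj /quad addr0. Qed.

Lemma set_gE T r Gs Gp C : set_g a T r Gs Gp C = set_obj T r 1 Gs Gp C.
Proof. by rewrite /set_g /set_f /set_obj /quad; ring. Qed.

(** Joining all remaining children to the root pays off once [#|C| >= a - 1]:
    with [k] of them left, the root term grows by [k (2 #|C| + k + 2 d - a)],
    which is at least [k (a - 1)] as [k >= 1], and each child loses at most
    [a - 1]. *)
Lemma candidates_suffice T r d Gs Gp C :
  0 <= d -> C \subset children T r r ->
  {in children T r r, forall v,
     qdso_obj a (Gs v) + 1 - a <= aux_obj a v (Gp v)} ->
  exists2 C', candidate a T r C' &
    set_obj T r d Gs Gp C <= set_obj T r d Gs Gp C'.
Proof.
set Ch := children T r r => d0 CS gain.
have [small|large] := ltP #|C|%:R (a - 1).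
  by exists C => //; split=> //; left.
have [->|neC] := eqVneq C Ch; first by exists Ch => //; split=> //; right.
exists Ch; first by split=> //; right.
rewrite /set_obj -/Ch setDv big_set0 addr0 [X in _ <= _ + X](big_setID C) /=.
rewrite (setIidPr CS).
have sum_gain : \sum_(v in Ch :\: C) qdso_obj a (Gs v)
    + (1 - a) * #|Ch :\: C|%:R <= \sum_(v in Ch :\: C) aux_obj a v (Gp v).
  rewrite mulr_natr -sumr_const -big_split /=; apply: ler_sum => v.
  by rewrite inE addrA => /andP[_ /gain].
have card_Ch : #|Ch|%:R = #|C|%:R + #|Ch :\: C|%:R :> R.
  by rewrite -natrD -(cardsID C Ch) (setIidPr CS).
have : 1 <= #|Ch :\: C|%:R :> R.
  rewrite ler1n card_gt0; apply: contraNneq neC => /eqP.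
  by rewrite setD_eq0 eqEsubset CS.
move: sum_gain large; rewrite card_Ch /quad.
move: (\sum_(v in C) _) (\sum_(v in _ :\: _) _) (\sum_(v in _ :\: _) _).
move: (#|C|%:R) (#|_ :\: _|%:R) => c k sC sF sG; nra.
Qed.

Section RootedTree.
Variables (T : graph U) (r : U).
Hypothesis treeT : rooted_tree T r.
Notation Ch := (children T r r).
Notation D := (descendants T r).

Let simpleT : simple_graph T. Proof. by case: treeT. Qed.
Let root_in : r \in vset T. Proof. by case: treeT. Qed.

Definition branch H v : graph U :=
  Graph (D v) [set e in eset H | e \subset D v].

Definition root_nbrs H : {set U} := [set v in Ch | [set r; v] \in eset H].

Lemma root_nbrs_sub H : root_nbrs H \subset Ch.
Proof. by apply/subsetP => v; rewrite inE => /andP[]. Qed.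

Lemma branch_spanning H v :
  spanning_subgraph H T -> spanning_subgraph (branch H v) (subtree T r v).
Proof.
case=> _ /subsetP HT; split=> //; apply/subsetP=> e.
by rewrite !inE => /andP[/HT-> ->].
Qed.

Lemma degree_root H :
  spanning_subgraph H T -> degree H r = #|root_nbrs H|.
Proof.
case=> _ /subsetP HT; rewrite -(card_imset _ (@set2_inj U r)).
apply: eq_card => e; rewrite inE; apply/andP/imsetP => [[eH re]|[v + ->]].
  have [v def_e rv] := edge_at simpleT (HT _ eH) re.
  by exists v; rewrite // inE mem_children // rv -def_e.
by rewrite inE set21 => /andP[].
Qed.

(** The edges at [w] that are not in the branch contain [r], and the only one
    that may be there is [[set r; v]], when [w = v]. *)
Lemma degree_branch H v w :
  spanning_subgraph H T -> v \in Ch -> w \in D v ->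
  degree H w = (degree (branch H v) w + ((w == v) && (v \in root_nbrs H)))%N.
Proof.
case=> _ /subsetP HT vC wD; pose at_root := [set e : {set U} | r \in e].
have offP e : (e \in [set e in eset H | w \in e] :\: at_root)
    = (e \in [set e in eset (branch H v) | w \in e]).
  apply/setDP/idP; rewrite !in_set; last first.
    case/andP=> /andP[eH eD] we; rewrite eH we; split=> //.
    by apply: contra (root_notin_descendants treeT vC); apply: (subsetP eD).
  case=> /andP[eH we] re.
  rewrite eH we /= andbT; apply: (edge_sub_descendants treeT) => //.
    exact: HT.
  by apply/pred0Pn; exists w; rewrite /= we.
rewrite /degree -(cardsID at_root) addnC (eq_card offP); congr addn.
have [/andP[/eqP-> vN]|not_nbr] := boolP ((w == v) && _).
  rewrite (_ : _ :&: _ = [set [set r; v]]) ?cards1 //.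
  apply/setP => e; rewrite in_set1 !in_set -andbA; apply/and3P/eqP => [[eH ve re]|->].
    have [y def_e _] := edge_at simpleT (HT _ eH) re.
    move: ve; rewrite def_e => /set2P[] vy; last by rewrite vy.
    by have := root_notin_descendants treeT vC; rewrite -[X in X \notin _]vy
      child_descendant.
  by move: vN; rewrite inE set21 set22 => /andP[_ ->].
apply: eq_card0 => e; rewrite !in_set -andbA; apply: contraNF not_nbr.
case/and3P=> eH we re; have eT := HT _ eH.
have [y def_e ry] := edge_at simpleT eT re.
have yC : y \in Ch by rewrite mem_children.
move: we; rewrite def_e => /set2P[] wy.
  by move: wD; rewrite wy (negPf (root_notin_descendants treeT vC)).
have yv : y = v.
  apply: (descendants_disjoint treeT yC vC (w := w)) => //.
  by rewrite wy child_descendant.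
by rewrite wy yv eqxx inE vC -yv -def_e.
Qed.

(** The edge from [r] to a child [v] in [root_nbrs H] counts once more in the
    degree of [v] than the branch shows, which turns the QDSO objective of the
    branch into its AUX objective. *)
Lemma shifted_obj_decomp d H : spanning_subgraph H T ->
  shifted_obj d r H = set_obj T r d (branch H) (branch H) (root_nbrs H).
Proof.
move=> HT; have vH : vset H = vset T by case: HT.
rewrite /shifted_obj vH (vset_partition treeT) (degree_root HT).
have sNC := root_nbrs_sub H.
rewrite (big_setID (root_nbrs H)) /= (setIidPr sNC) addrA /set_obj.
congr (_ + _ + _); apply: eq_bigr => v.
  move=> vN; have vC := subsetP sNC _ vN.
  have vD := child_descendant treeT vC.
  rewrite (big_setD1 v vD) (degree_branch HT vC vD) eqxx vN natrD.
  congr (_ + _); apply: eq_bigr => w; rewrite in_setD1 => /andP[wv wD].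
  by rewrite (degree_branch HT vC wD) (negPf wv) addn0.
case/setDP=> vC vN; apply: eq_bigr => w wD.
by rewrite (degree_branch HT vC wD) (negPf vN) andbF addn0.
Qed.

Definition chosen Gs Gp C v : graph U := if v \in C then Gp v else Gs v.

Section Assemble.
Variables (Gs Gp : U -> graph U) (C : {set U}).
Hypothesis sub_s : {in Ch, forall v, spanning_subgraph (Gs v) (subtree T r v)}.
Hypothesis sub_p : {in Ch, forall v, spanning_subgraph (Gp v) (subtree T r v)}.
Hypothesis sub_C : C \subset Ch.

Local Notation part := (chosen Gs Gp C).

Let sub_part : {in Ch, forall v, spanning_subgraph (part v) (subtree T r v)}.
Proof.
by move=> v vC; rewrite /chosen; case: ifP => _; [apply: sub_p | apply: sub_s].
Qed.

Lemma vset_bigunion (A : {set U}) (F : U -> graph U) :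
  vset (\big[@gunion U/gempty]_(v in A) F v) = \bigcup_(v in A) vset (F v).
Proof. exact: (big_morph (@vset U)). Qed.

Lemma eset_bigunion (A : {set U}) (F : U -> graph U) :
  eset (\big[@gunion U/gempty]_(v in A) F v) = \bigcup_(v in A) eset (F v).
Proof. exact: (big_morph (@eset U)). Qed.

Lemma mem_assemble e :
  reflect ((exists2 v, v \in C & e = [set r; v]) \/
           (exists2 v, v \in Ch & e \in eset (part v)))
          (e \in eset (assemble T r Gs Gp C)).
Proof.
apply: (iffP setUP) => [] [He|He]; first by left; apply/imsetP.
- right; move: He; rewrite /= eset_bigunion eset_bigunion.
  case/setUP=> /bigcupP[v vA ev].
    by exists v; rewrite ?(subsetP sub_C) // /chosen vA.
  by case/setDP: vA => vC vN; exists v; rewrite // /chosen (negPf vN).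
- by left; apply/imsetP.
right; case: He => v vC; rewrite /= eset_bigunion eset_bigunion /chosen => ev.
apply/setUP; move: ev; case: ifPn => vN ev; [left | right]; apply/bigcupP.
  by exists v.
by exists v; rewrite // inE vN.
Qed.

Let part_edge v e : v \in Ch -> e \in eset (part v) ->
  e \in eset T /\ e \subset D v.
Proof.
move=> vC ev; have [_ /subsetP/(_ _ ev)] := sub_part vC.
by rewrite inE => /andP[].
Qed.

Let edge_ex e : e \in eset T -> exists x, x \in e.
Proof.
by move=> /simpleT[_ e2]; apply/card_gt0P; rewrite e2.
Qed.

Lemma assemble_spanning : spanning_subgraph (assemble T r Gs Gp C) T.
Proof.
split; last first.
  apply/subsetP => e /mem_assemble[[v vC ->]|[v vC /(part_edge vC)[]//]].
  by move/(subsetP sub_C): vC; rewrite mem_children.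
rewrite /= !vset_bigunion; apply/setP => x; apply/idP/idP.
  case/setUP=> [/setU1P[->//|]|].
    by move/(subsetP sub_C); rewrite mem_children // => /(adj_vset simpleT)[].
  case/setUP=> /bigcupP[v].
    move/(subsetP sub_C) => vC; have [-> _] := sub_p vC.
    exact/subsetP/descendants_vset.
  case/setDP=> vC _; have [-> _] := sub_s vC.
  exact/subsetP/descendants_vset.
move=> xT; have [->|xr] := eqVneq x r; first by rewrite in_setU setU11.
have [v vC xD] := descendants_cover treeT xT xr.
apply/setUP; right; apply/setUP.
have [vN|vN] := boolP (v \in C); [left|right]; apply/bigcupP; exists v => //.
- by have [-> _] := sub_p vC.
- by rewrite inE vN.
- by have [-> _] := sub_s vC.
Qed.

Lemma root_nbrs_assemble : root_nbrs (assemble T r Gs Gp C) = C.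
Proof.
apply/setP => v; rewrite in_set; apply/andP/idP => [[vC]|vC]; last first.
  by split; [apply: (subsetP sub_C) | apply/mem_assemble; left; exists v].
case/mem_assemble=> [[u uC /set2_inj->//]|[u uC /(part_edge uC)[_]]].
move/subsetP/(_ r).
by rewrite set21 (negPf (root_notin_descendants treeT uC)) => /(_ isT).
Qed.

Lemma branch_assemble v : v \in Ch ->
  branch (assemble T r Gs Gp C) v = part v.
Proof.
move=> vC; have [vD _] := sub_part vC.
rewrite [RHS](_ : _ = Graph (vset (part v)) (eset (part v))); last first.
  by case: (part v).
congr Graph; first by rewrite vD.
apply/setP => e; rewrite in_set; apply/andP/idP => [[]|ev]; last first.
  have [_ eD] := part_edge vC ev; split=> //.
  by apply/mem_assemble; right; exists v.
case/mem_assemble=> [[u uC ->] /subsetP/(_ r)|[u uC eu] eD].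
  by rewrite set21 (negPf (root_notin_descendants treeT vC)) => /(_ isT).
have [eT eDu] := part_edge uC eu; have [x xe] := edge_ex eT.
have -> // : v = u.
by apply: (descendants_disjoint treeT vC uC (w := x)); apply: (subsetP _ _ xe).
Qed.

Lemma shifted_obj_assemble d :
  shifted_obj d r (assemble T r Gs Gp C) = set_obj T r d Gs Gp C.
Proof.
rewrite (shifted_obj_decomp _ assemble_spanning) root_nbrs_assemble /set_obj.
congr (_ + _ + _); apply: eq_bigr => v.
  by move=> vC; rewrite branch_assemble ?(subsetP sub_C) // /chosen vC.
by case/setDP=> vC vN; rewrite branch_assemble // /chosen (negPf vN).
Qed.

End Assemble.

(** Any [H] is dominated by the assembly over its own root neighbours, then by
    one over a candidate set; the gain of at least [1 - a] required by
    [candidates_suffice] comes from evaluating AUX at the optimum of QDSO. *)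
Lemma assemble_optimal d Gs Gp C :
    0 <= d ->
    {in Ch, forall v, solves_QDSO a (subtree T r v) (Gs v)} ->
    {in Ch, forall v, solves_AUX a (subtree T r v) v (Gp v)} ->
    is_maximizer (candidate a T r) (set_obj T r d Gs Gp) C ->
  is_maximizer (fun H => spanning_subgraph H T) (shifted_obj d r)
    (assemble T r Gs Gp C).
Proof.
move=> d0 optS optP [[CS _] maxC].
have sub_s : {in Ch, forall v, spanning_subgraph (Gs v) (subtree T r v)}.
  by move=> v /optS[].
have sub_p : {in Ch, forall v, spanning_subgraph (Gp v) (subtree T r v)}.
  by move=> v /optP[].
split=> [|H HT]; first exact: assemble_spanning.
have sNC := root_nbrs_sub H.
rewrite shifted_obj_assemble // shifted_obj_decomp //.
apply: (@le_trans _ _ (set_obj T r d Gs Gp (root_nbrs H))).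
  rewrite /set_obj !lerD //; apply: ler_sum => v.
    move/(subsetP sNC) => vC; have [_ ->//] := optP _ vC.
    exact: branch_spanning.
  by case/setDP=> vC _; have [_ ->//] := optS _ vC; apply: branch_spanning.
have [v vC|C' C'ok le_C'] := @candidates_suffice T r d Gs Gp _ d0 sNC.
  have [_ /(_ _ (sub_s v vC))] := optP _ vC; apply: le_trans.
  rewrite (@aux_qdso_obj v (Gs v)); last first.
    by have [-> _] := sub_s _ vC; apply: child_descendant.
  by rewrite lerD2r lerD2r lerDl mulr_ge0.
exact: le_trans le_C' (maxC _ C'ok).
Qed.

End RootedTree.

Lemma is_maximizer_ext (A : Type) (P : A -> Prop) (obj obj' : A -> R) (x : A) :
  (forall y, P y -> obj y = obj' y) ->
  is_maximizer P obj x -> is_maximizer P obj' x.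
Proof. by move=> eq_obj [Px max_x]; split=> // y Py; rewrite -!eq_obj ?max_x. Qed.

Lemma alg_run_optimal T r G H :
  alg_run a T r G H -> rooted_tree T r ->
  solves_QDSO a T G /\ solves_AUX a T r H.
Proof.
elim=> {}T {}r Gs Gp Cs Cp _ IH maxS maxP treeT.
have optS : {in children T r r, forall v, solves_QDSO a (subtree T r v) (Gs v)}.
  by move=> v vC; case: (IH v vC (subtree_rooted treeT vC)).
have optP : {in children T r r, forall v, solves_AUX a (subtree T r v) v (Gp v)}.
  by move=> v vC; case: (IH v vC (subtree_rooted treeT vC)).
split.
  apply: (@is_maximizer_ext _ _ (shifted_obj 0 r)) => [G' [vG' _]|].
    by rewrite -qdso_objE // vG'; case: treeT.
  apply: assemble_optimal => //; apply: is_maximizer_ext maxS => C _.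
  exact: set_fE.
apply: assemble_optimal => //; apply: is_maximizer_ext maxP => C _.
exact: set_gE.
Qed.

End Objectives.


(** * The program *)

(* The functions of the program are called by their position in it. *)
Local Notation main_fn := 0%N (only parsing).
Local Notation solve_fn := 1%N (only parsing).
Local Notation split_fn := 2%N (only parsing).
Local Notation kids_fn := 3%N (only parsing).
Local Notation insert_fn := 4%N (only parsing).
Local Notation best_fn := 5%N (only parsing).
Local Notation append_fn := 6%N (only parsing).
Local Notation rest_fn := 7%N (only parsing).

(** Argument [(l1, l2)]: concatenation of two lists. *)
Definition append_body : expr :=
  EIfPair (EFst (EVar 0))
    (EPair (EFst (EFst (EVar 0)))
       (ECall append_fn (EPair (ESnd (EFst (EVar 0))) (ESnd (EVar 0)))))
    (ESnd (EVar 0)).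

(* What is known about a child [v] is kept in a record
   [(v, ((edges of G*_v, edges of G+_v), (f (G*_v), g (G+_v))))]. *)
Local Notation rec_name x := (EFst x).
Local Notation rec_Es x := (EFst (EFst (ESnd x))).
Local Notation rec_Ep x := (ESnd (EFst (ESnd x))).
Local Notation rec_f x := (EFst (ESnd (ESnd x))).
Local Notation rec_g x := (ESnd (ESnd (ESnd x))).
Local Notation rec_gain x := (EArith Defs.Sub (rec_g x) (rec_f x)).

(** Argument [(x, L)]: inserts the record [x] into the list [L] of records
    sorted by decreasing gain. *)
Definition insert_body : expr :=
  EIfPair (ESnd (EVar 0))
    (EIfLe (rec_gain (EFst (ESnd (EVar 0)))) (rec_gain (EFst (EVar 0)))
       (EPair (EFst (EVar 0)) (ESnd (EVar 0)))
       (EPair (EFst (ESnd (EVar 0)))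
          (ECall insert_fn (EPair (EFst (EVar 0)) (ESnd (ESnd (EVar 0)))))))
    (EPair (EFst (EVar 0)) ENil).

(** Argument [L]: the total QDSO objective and all the edges below the children
    in [L], none of which is joined to the root. *)
Definition rest_body : expr :=
  EIfPair (EVar 0)
    (ELet (ECall rest_fn (ESnd (EVar 0)))
       (EPair (EArith Defs.Add (rec_f (EFst (EVar 1))) (EFst (EVar 0)))
          (ECall append_fn (EPair (rec_Es (EFst (EVar 1))) (ESnd (EVar 0))))))
    (EPair (ENum 0) ENil).

(* The argument of the next function is [(L, (r, (a, (k, d))))]. *)
Local Notation best_L x := (EFst x).
Local Notation best_r x := (EFst (ESnd x)).
Local Notation best_a x := (EFst (ESnd (ESnd x))).
Local Notation best_k x := (EFst (ESnd (ESnd (ESnd x)))).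
Local Notation best_d x := (ESnd (ESnd (ESnd (ESnd x)))).
Local Notation best_quad x :=
  (EArith Defs.Mul (EArith Defs.Add (best_k x) (best_d x))
     (EArith Defs.Sub (EArith Defs.Add (best_k x) (best_d x)) (best_a x))).

(** When [k] children have been joined to the root and the sorted list [L]
    remains, there are two options: join the first child of [L] and go on, or
    stop and leave all of [L] unjoined, which is a candidate if [k < a - 1].
    The result is the value and the edges of the better one. *)
Definition best_body : expr :=
  EIfPair (best_L (EVar 0))
    (ELet (ECall best_fn (EPair (ESnd (best_L (EVar 0)))
             (EPair (best_r (EVar 0)) (EPair (best_a (EVar 0))
                (EPair (EArith Defs.Add (best_k (EVar 0)) (ENum 1))
                   (best_d (EVar 0)))))))
    (ELet (EPair (EArith Defs.Add (rec_g (EFst (best_L (EVar 1)))) (EFst (EVar 0)))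
             (EPair (EPair (best_r (EVar 1)) (rec_name (EFst (best_L (EVar 1)))))
                (ECall append_fn (EPair (rec_Ep (EFst (best_L (EVar 1))))
                            (ESnd (EVar 0))))))
    (EIfLe (EArith Defs.Sub (best_a (EVar 2)) (ENum 1)) (best_k (EVar 2))
       (EVar 0)
       (ELet (ECall rest_fn (best_L (EVar 2)))
       (EIfLe (EArith Defs.Add (best_quad (EVar 3)) (EFst (EVar 0))) (EFst (EVar 1))
          (EVar 1)
          (EPair (EArith Defs.Add (best_quad (EVar 3)) (EFst (EVar 0)))
             (ESnd (EVar 0))))))))
    (EPair (best_quad (EVar 0)) ENil).

(** Argument [(cs, (E, a))]: the sorted list of records of the children [cs]. *)
Definition kids_body : expr :=
  EIfPair (EFst (EVar 0))
    (ECall insert_fn (EPair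
       (EPair (EFst (EFst (EVar 0)))
          (ECall solve_fn (EPair (EFst (EFst (EVar 0))) (ESnd (EVar 0)))))
       (ECall kids_fn (EPair (ESnd (EFst (EVar 0))) (ESnd (EVar 0))))))
    ENil.

(** Argument [(r, E)]: the neighbours of [r] along the edges in [E], and the
    edges in [E] that avoid [r]. *)
Definition split_body : expr :=
  EIfPair (ESnd (EVar 0))
    (ELet (ECall split_fn (EPair (EFst (EVar 0)) (ESnd (ESnd (EVar 0)))))
    (EIfEq (EFst (EFst (ESnd (EVar 1)))) (EFst (EVar 1))
       (EPair (EPair (ESnd (EFst (ESnd (EVar 1)))) (EFst (EVar 0)))
          (ESnd (EVar 0)))
    (EIfEq (ESnd (EFst (ESnd (EVar 1)))) (EFst (EVar 1))
       (EPair (EPair (EFst (EFst (ESnd (EVar 1)))) (EFst (EVar 0)))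
          (ESnd (EVar 0)))
       (EPair (EFst (EVar 0))
          (EPair (EFst (ESnd (EVar 1))) (ESnd (EVar 0)))))))
    (EPair ENil ENil).

(** Argument [(r, (E, a))]: the edges of G*_r and G+_r and their objectives. *)
Definition solve_body : expr :=
  ELet (ECall split_fn (EPair (EFst (EVar 0)) (EFst (ESnd (EVar 0)))))
  (ELet (ECall kids_fn (EPair (EFst (EVar 0))
           (EPair (ESnd (EVar 0)) (ESnd (ESnd (EVar 1))))))
  (ELet (ECall best_fn (EPair (EVar 0) (EPair (EFst (EVar 2))
           (EPair (ESnd (ESnd (EVar 2))) (EPair (ENum 0) (ENum 0))))))
  (ELet (ECall best_fn (EPair (EVar 1) (EPair (EFst (EVar 3))
           (EPair (ESnd (ESnd (EVar 3))) (EPair (ENum 0) (ENum 1))))))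
  (EPair (EPair (ESnd (EVar 1)) (ESnd (EVar 0)))
     (EPair (EFst (EVar 1)) (EFst (EVar 0))))))).

(** Both outputs are spanning subgraphs, so the list of input vertices serves for
    them too. *)
Definition main_body : expr :=
  ELet (ECall solve_fn (EPair (EFst (ESnd (EVar 0)))
          (EPair (ESnd (EFst (EVar 0))) (ESnd (ESnd (EVar 0))))))
  (EPair (EPair (EPair (EFst (EFst (EVar 1))) (EFst (EFst (EVar 0))))
            (EPair (EFst (EFst (EVar 1))) (ESnd (EFst (EVar 0)))))
     (ESnd (EVar 0))).

Definition tree_program : program :=
  [:: main_body; solve_body; split_body; kids_body; insert_body; best_body;
      append_body; rest_body].

(** * Evaluation of the program *)

(* Symbolic evaluation of a body.  Calls are resolved by a hypothesis on the
   function called, comparisons by a hypothesis on their truth value. *)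
Ltac ev :=
  lazymatch goal with
  | |- eval ?P ?s (nth ENil ?Q ?f) ?v ?t =>
      let e := eval hnf in (nth ENil Q f) in change (eval P s e v t); ev
  | |- eval _ _ (EVar _) _ _ => eapply EvVar; reflexivity
  | |- eval _ _ ENil _ _ => eapply EvNil
  | |- eval _ _ (ENum _) _ _ => eapply EvNum
  | |- eval _ _ (EPair _ _) _ _ => eapply EvPair; [ev | ev]
  | |- eval _ _ (EFst _) _ _ => eapply EvFst; ev
  | |- eval _ _ (ESnd _) _ _ => eapply EvSnd; ev
  | |- eval _ _ (EArith _ _ _) _ _ => eapply EvArith; [ev | ev]
  | |- eval _ _ (ELet _ _) _ _ => eapply EvLet; [ev | ev]
  | |- eval _ _ (ECall _ _) _ _ => eapply EvCall; [ev | eassumption]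
  | |- eval _ _ (EIfPair _ _ _) _ _ =>
      eapply EvIfPair;
      [ev | lazymatch goal with |- eval ?P ?s ?e ?v ?t =>
              let e' := eval hnf in e in change (eval P s e' v t)
            end; ev]
  | |- eval _ _ (EIfEq _ _ _ _) _ _ => eapply EvIfEq; [ev | ev | ev_if; ev]
  | |- eval _ _ (EIfLe _ _ _ _) _ _ => eapply EvIfLe; [ev | ev | ev_if; ev]
  end
with ev_if :=
  cbn [arith_op];
  match goal with
  | H : ?c = true |- context [?c] => rewrite H
  | H : ?c = false |- context [?c] => rewrite H
  end.

Lemma eval_eq (R : realType) (U : finType) (P : program) s e
    (v v' : value R U) t :
  eval P s e v t -> v = v' -> eval P s e v' t.
Proof. by move=> ? <-. Qed.

Ltac run := eexists; [|eapply eval_eq; [ev | reflexivity]].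

Section Execution.
Variables (R : realType) (U : finType).
Local Notation value := (value R U).

(* The numerical constants in the bounds below are generous estimates of the
   number of steps in one evaluation of a body. *)

Definition calls f (u v : value) (b : nat) : Prop :=
  exists2 t, (t <= b)%N &
    eval tree_program [:: u] (nth ENil tree_program f) v t.

Definition enc_edges (es : seq (U * U)) : value :=
  vlist [seq VPair (VName e.1) (VName e.2) | e <- es].

Definition enc_names (vs : seq U) : value := vlist [seq VName v | v <- vs].

Lemma append_calls es1 es2 :
  calls append_fn (VPair (enc_edges es1) (enc_edges es2)) (enc_edges (es1 ++ es2))
    (30 * (size es1).+1).
Proof.
elim: es1 => [|e es1 [t le_t IH]] /=.
  by eexists; [|ev]; lia.
by eexists; [|ev]; lia.
Qed.

Lemma split_calls r es :
  let incident := fun e : U * U => (e.1 == r) || (e.2 == r) in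
  calls split_fn (VPair (VName r) (enc_edges es))
    (VPair (enc_names
              [seq if e.1 == r then e.2 else e.1 | e <- es & incident e])
       (enc_edges [seq e <- es | ~~ incident e]))
    (60 * (size es).+1).
Proof.
elim: es => [|[x y] es [t le_t IH]] /=; first by eexists; [|ev]; lia.
case E: (x == r) => /=; first by rewrite E; eexists; [|ev]; lia.
by case E2: (y == r) => /=; rewrite ?E; eexists; [|ev|..|ev]; lia.
Qed.

Section Records.
Variables (Es Ep : U -> seq (U * U)) (fs gp : U -> R).
Implicit Types (u v x : U) (cs : seq U) (j k : nat).

Definition record v : value :=
  VPair (VName v) (VPair (VPair (enc_edges (Es v)) (enc_edges (Ep v)))
                         (VPair (VNum (fs v)) (VNum (gp v)))).

Definition enc_records cs : value := vlist [seq record v | v <- cs].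

Definition gain_ge u v := gp v - fs v <= gp u - fs u.

Lemma insert_calls x cs :
  calls insert_fn (VPair (record x) (enc_records cs))
    (enc_records (merge gain_ge [:: x] cs)) (60 * (size cs).+1).
Proof.
elim: cs => [|y cs [t le_t IH]] /=; first by eexists; [|ev]; lia.
by rewrite {1}/gain_ge; case E: (_ <= _); eexists; [|ev|..|ev]; lia.
Qed.

Section Bounded.
Variable m : nat.
Hypothesis sizeEs : forall v, (size (Es v) <= m)%N.
Hypothesis sizeEp : forall v, (size (Ep v) <= m)%N.

Lemma rest_calls cs :
  calls rest_fn (enc_records cs)
    (VPair (VNum (\sum_(v <- cs) fs v))
       (enc_edges (flatten [seq Es v | v <- cs])))
    (100 * (size cs).+1 * m.+1).
Proof.
elim: cs => [|x cs [t le_t IH]] /=.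
  by rewrite big_nil; eexists; [|ev]; lia.
rewrite big_cons.
have [t' le_t' app] := append_calls (Es x) (flatten [seq Es v | v <- cs]).
have := sizeEs x => ?.
by eexists; [|ev]; nia.
Qed.

Section Prefixes.
Variables (r : U) (a d : R).

(** The value of joining the first [j] children of the list when [k] other
    children are joined to the root already; [d] is the shift that selects QDSO
    or AUX. *)
Definition prefix_obj k j cs : R :=
  quad a (k%:R + j%:R + d) + \sum_(v <- take j cs) gp v
  + \sum_(v <- drop j cs) fs v.

Definition prefix_edges j cs : seq (U * U) :=
  flatten [seq (r, v) :: Ep v | v <- take j cs]
  ++ flatten [seq Es v | v <- drop j cs].

Definition prefix_ok k cs j : Prop :=
  (j <= size cs)%N /\ (k%:R + j%:R < a - 1 \/ j = size cs).

(** The recursion is over [cs] with [k] increasing: a prefix of length [j + 1]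
    seen from [k] is a prefix of length [j] of the tail seen from [k + 1]. *)
Lemma best_calls k cs : (size cs <= m)%N ->
  exists2 j, is_maximizer (prefix_ok k cs) (fun j => prefix_obj k j cs) j &
    calls best_fn
      (VPair (enc_records cs)
         (VPair (VName r) (VPair (VNum a) (VPair (VNum k%:R) (VNum d)))))
      (VPair (VNum (prefix_obj k j cs)) (enc_edges (prefix_edges j cs)))
      (300 * (size cs).+1 * m.+1 ^ 2).
Proof.
elim: cs k => [|x cs IH] k /= le_m.
  exists 0%N; first by split=> [|j [/= +  _]]; [split=> //; right | case: j].
  rewrite /prefix_obj /= !big_nil !addr0.
  by run; nia.
have [j [[le_j okj] max_j] [t le_t take_x]] := IH k.+1 (ltnW le_m).
have k1 : k.+1%:R = k%:R + 1%:R :> R by rewrite -addn1 natrD.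
have shift i : prefix_obj k i.+1 (x :: cs) = gp x + prefix_obj k.+1 i cs.
  by rewrite /prefix_obj /quad /= big_cons k1 -[i.+1]addn1 natrD; ring.
have shift_edges :
    prefix_edges j.+1 (x :: cs) = (r, x) :: Ep x ++ prefix_edges j cs.
  by rewrite /prefix_edges /= catA.
have max_take i : prefix_ok k (x :: cs) i.+1 ->
    prefix_obj k i.+1 (x :: cs) <= prefix_obj k j.+1 (x :: cs).
  move=> [le_i ok_i]; rewrite !shift lerD2l; apply: max_j; split=> //.
  case: ok_i => [ok_i|[->]]; [left | by right].
  by move: ok_i; rewrite k1 -[i.+1]addn1 natrD; lra.
have ok_take : prefix_ok k (x :: cs) j.+1.
  split=> //; case: okj => [okj|->]; [left | by right].
  by move: okj; rewrite k1 -[j.+1]addn1 natrD; lra.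
rewrite {1}k1 in take_x.
have [t1 le_t1 app] := append_calls (Ep x) (prefix_edges j cs).
have [t2 le_t2 rest] := rest_calls (x :: cs).
have := sizeEp x => sx.
case E: (a - 1%:R <= k%:R :> R).
  exists j.+1.
    split=> // -[[_ [|//]]|i]; last exact: max_take.
    by rewrite addr0 ltNge E.
  rewrite shift shift_edges.
  by run; simpl in *; nia.
have ok0 : prefix_ok k (x :: cs) 0.
  by split=> //; left; rewrite addr0 ltNge E.
have e0 : prefix_obj k 0 (x :: cs)
    = (k%:R + d) * (k%:R + d - a) + \sum_(v <- x :: cs) fs v.
  by rewrite /prefix_obj /quad take0 drop0 big_nil !addr0.
case E2 : (prefix_obj k 0 (x :: cs) <= prefix_obj k j.+1 (x :: cs)).
  exists j.+1; first by split=> // -[_|i] //; exact: max_take.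
  move: E2; rewrite e0 shift shift_edges => E2.
  by run; simpl in *; nia.
exists 0%N.
  split=> // -[_|i] // /max_take /le_trans -> //.
  by move: (negbT E2); rewrite -ltNge => /ltW.
move: E2; rewrite e0 shift => E2.
by run; simpl in *; nia.
Qed.

End Prefixes.
End Bounded.

(** Inserting an element is merging with a one-element list, so that insertion
    sort inherits the properties of [merge]. *)
Definition sort_by_gain cs : seq U :=
  foldr (fun v s => merge gain_ge [:: v] s) [::] cs.

Lemma sort_by_gain_perm cs : perm_eq (sort_by_gain cs) cs.
Proof. by elim: cs => //= v cs IH; rewrite perm_merge /= perm_cons. Qed.

Lemma sort_by_gain_sorted cs : sorted gain_ge (sort_by_gain cs).
Proof.
elim: cs => //= v cs IH; apply: merge_sorted IH => //.
by move=> x y; apply: le_total.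
Qed.

Lemma kids_calls cs ea b :
  {in cs, forall v,
     calls solve_fn (VPair (VName v) ea)
       (VPair (VPair (enc_edges (Es v)) (enc_edges (Ep v)))
              (VPair (VNum (fs v)) (VNum (gp v)))) (b v)} ->
  calls kids_fn (VPair (enc_names cs) ea) (enc_records (sort_by_gain cs))
    (\sum_(v <- cs) b v + 100 * (size cs).+1 ^ 2).
Proof.
elim: cs => [|v cs IH] solves /=; first by rewrite big_nil; run; lia.
have [u ucs|t le_t kids] := IH; first by apply: solves; rewrite inE ucs orbT.
have [t1 le_t1 solve] := solves v (mem_head _ _).
have [t2 le_t2 insert] := insert_calls v (sort_by_gain cs).
rewrite (perm_size (sort_by_gain_perm cs)) in le_t2.
rewrite big_cons; run; clear -le_t le_t1 le_t2; simpl in *.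
move: (\sum_(j <- cs) b j)%N (size cs) (b v) le_t le_t1 le_t2 => S n bv.
nia.
Qed.

(** Putting a largest element in front of a sorted list can only increase the
    sums of its prefixes that do exist. *)
Lemma sorted_take_le x cs k : path gain_ge x cs -> (k <= size cs)%N ->
  \sum_(v <- take k cs) (gp v - fs v)
    <= \sum_(v <- take k (x :: cs)) (gp v - fs v).
Proof.
elim: cs x k => [|y cs IH] x [|k] //= /andP[xy ycs] le_k.
by rewrite !big_cons lerD // IH.
Qed.

(** The greedy choice: among the sets of a given size, the first elements of the
    sorted list have the largest total gain. *)
Lemma sorted_take_max (A : pred U) cs : sorted gain_ge cs ->
  \sum_(v <- cs | A v) (gp v - fs v)
    <= \sum_(v <- take (count A cs) cs) (gp v - fs v).
Proof.
elim: cs => [|x cs IH] /=; first by rewrite !big_nil.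
move=> xcs; have {}IH := IH (path_sorted xcs).
rewrite big_cons; case: (A x); first by rewrite /= big_cons lerD2l.
by rewrite add0n; apply: le_trans IH (sorted_take_le xcs (count_size _ _)).
Qed.

End Records.

End Execution.

(** * Lists of edges *)

Section EdgeLists.
Variable U : finType.
Implicit Types (T : graph U) (r u v x : U) (es : seq (U * U)).

Definition edge_sets es : seq {set U} := [seq [set e.1; e.2] | e <- es].

(** The list may contain further edges, as long as they do not meet the tree.
    This makes one list serve for the subtrees of all children of a vertex. *)
Definition lists_edges es T : Prop :=
  uniq (edge_sets es) /\
  forall e, (e \in eset T)
    = (e \in edge_sets es) && ~~ [disjoint e & vset T].

Lemma lists_all_edges es T : simple_graph T ->
  uniq (edge_sets es) -> edge_sets es =i eset T -> lists_edges es T.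
Proof.
move=> sT ues mem_es; split=> // e; rewrite mem_es andb_idr // => eT.
have [/subsetP sub e2] := sT _ eT.
have /card_gt0P[x xe] : (0 < #|e|)%N by rewrite e2.
by apply/pred0Pn; exists x; rewrite /= xe sub.
Qed.

Lemma uniq_flatten_map (A : eqType) (F : U -> seq A) (vs : seq U) :
  uniq vs -> {in vs, forall v, uniq (F v)} ->
  {in vs &, forall u v (x : A), x \in F u -> x \in F v -> u = v} ->
  uniq (flatten [seq F v | v <- vs]).
Proof.
elim: vs => //= v vs IH /andP[vvs uvs] uF disF.
rewrite cat_uniq uF ?mem_head //= IH //; last first.
- by move=> x y xs ys; apply: disF; rewrite inE ?xs ?ys orbT.
- by move=> x xs; apply: uF; rewrite inE xs orbT.
rewrite andbT; apply/hasPn => x /flatten_mapP[w ws xw].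
apply: contraNN vvs => xv.
by rewrite (disF v w (mem_head _ _) _ x) // inE ws orbT.
Qed.

Section RootedTree.
Variables (T : graph U) (r : U).
Hypothesis treeT : rooted_tree T r.
Notation Ch := (children T r r).

Let simpleT : simple_graph T. Proof. by case: treeT. Qed.
Let root_in : r \in vset T. Proof. by case: treeT. Qed.

Section Split.
Variable es : seq (U * U).
Hypothesis es_T : lists_edges es T.
Let incident (e : U * U) := (e.1 == r) || (e.2 == r).
Let cs := [seq if e.1 == r then e.2 else e.1 | e <- es & incident e].
Let es' := [seq e <- es | ~~ incident e].

Let star : [seq [set r; v] | v <- cs] = edge_sets [seq e <- es | incident e].
Proof.
rewrite /cs -map_comp; apply/eq_in_map => -[x y].
rewrite mem_filter /incident /= => /andP[+ _].
by case: eqVneq => [->|_] //= /eqP->; rewrite setUC.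
Qed.

Lemma split_children_uniq : uniq cs.
Proof.
apply: (@map_uniq _ _ (fun v => [set r; v])); rewrite star.
by case: es_T => ues _; apply: subseq_uniq ues; rewrite map_subseq ?filter_subseq.
Qed.

Lemma split_children v : (v \in cs) = (v \in Ch).
Proof.
rewrite mem_children // /adj; case: es_T => _ ->.
rewrite -(mem_map (@set2_inj U r)) star.
have -> : ~~ [disjoint [set r; v] & vset T].
  by apply/pred0Pn; exists r; rewrite /= set21.
rewrite andbT; apply/mapP/mapP => -[e + def_e].
  by rewrite mem_filter => /andP[_ ees]; exists e.
move=> ees; exists e; rewrite // mem_filter ees andbT /incident.
by have := set21 r v; rewrite def_e => /set2P[]->; rewrite eqxx ?orbT.
Qed.

(** An edge of the tree that avoids [r] and meets the descendants of [v] lies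
    among them, so deleting the edges at [r] leaves a valid list for every
    child. *)
Lemma split_rest v : v \in Ch -> lists_edges es' (subtree T r v).
Proof.
move=> vC; have [ues mem_es] := es_T; split.
  by apply: subseq_uniq ues; rewrite map_subseq ?filter_subseq.
have rD := root_notin_descendants treeT vC.
have mem_es' e : (e \in edge_sets es') = (e \in edge_sets es) && (r \notin e).
  apply/mapP/andP => [[p + ->]|[/mapP[p pes ->] rp]].
    rewrite mem_filter /incident => /andP[np pes]; split; first exact: map_f.
    by rewrite !inE ![r == _]eq_sym.
  exists p; rewrite // mem_filter pes andbT.
  by move: rp; rewrite !inE ![r == _]eq_sym.
move=> e; rewrite mem_es' in_set.
apply/andP/andP => [[eT eD]|[/andP[ees re] meet]].
  have /andP[-> _] : (e \in edge_sets es) && ~~ [disjoint e & vset T].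
    by rewrite -mem_es.
  split; first by apply: contra rD; apply: (subsetP eD).
  have [_ e2] := simpleT eT; have /card_gt0P[x xe] : (0 < #|e|)%N by rewrite e2.
  by apply/pred0Pn; exists x; rewrite /= xe (subsetP eD).
have eT : e \in eset T.
  rewrite mem_es ees; apply: contra meet; apply: disjointWr.
  exact: descendants_vset.
by split=> //; apply: (edge_sub_descendants treeT).
Qed.

Lemma split_size : (size cs <= size es)%N.
Proof. by rewrite size_map size_filter count_size. Qed.

End Split.

(** No edge is listed twice: the edges contributed by a child [v] all have an end
    among the descendants of [v], and no end among those of another child. *)
Lemma prefix_edges_assemble Gs Gp Es Ep (cs : seq U) j :
    {in Ch, forall v, spanning_subgraph (Gs v) (subtree T r v)} ->
    {in Ch, forall v, spanning_subgraph (Gp v) (subtree T r v)} ->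
    {in Ch, forall v,
       uniq (edge_sets (Es v)) /\ edge_sets (Es v) =i eset (Gs v)} ->
    {in Ch, forall v,
       uniq (edge_sets (Ep v)) /\ edge_sets (Ep v) =i eset (Gp v)} ->
    uniq cs -> cs =i Ch ->
  uniq (edge_sets (prefix_edges Es Ep r j cs)) /\
  edge_sets (prefix_edges Es Ep r j cs)
    =i eset (assemble T r Gs Gp [set v in take j cs]).
Proof.
move=> sub_s sub_p Es_Gs Ep_Gp ucs mem_cs; set C := [set v in take j cs].
have sub_C : C \subset Ch.
  by apply/subsetP => v; rewrite inE -mem_cs; apply: mem_take.
pose part := chosen Gs Gp C.
pose block v :=
  if v \in C then [set r; v] :: edge_sets (Ep v) else edge_sets (Es v).
have blocks :
    edge_sets (prefix_edges Es Ep r j cs) = flatten [seq block v | v <- cs].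
  rewrite -[X in [seq block _ | _ <- X]](cat_take_drop j) map_cat flatten_cat.
  rewrite /edge_sets /prefix_edges map_cat !map_flatten -!map_comp.
  congr (flatten _ ++ flatten _); apply/eq_in_map => v vj /=; rewrite /block inE.
    by rewrite vj.
  case: ifP => // v_take; move: ucs.
  rewrite -(cat_take_drop j cs) cat_uniq => /and3P[_ /hasPn/(_ v vj) + _].
  by rewrite /= v_take.
have edge_part v e : v \in Ch -> e \in eset (part v) ->
    [/\ e \subset descendants T r v & exists x, x \in e].
  move=> vC; have [_ /subsetP sub] : spanning_subgraph (part v) (subtree T r v).
    by rewrite /part /chosen; case: ifP => _; [apply: sub_p | apply: sub_s].
  move=> /sub; rewrite inE => /andP[/simpleT[_ e2] eD]; split=> //.
  by apply/card_gt0P; rewrite e2.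
have mem_block v e : v \in Ch ->
    (e \in block v) = ((v \in C) && (e == [set r; v])) || (e \in eset (part v)).
  move=> vC; rewrite /block /part /chosen; case: ifP => _ /=.
    by rewrite inE; have [_ ->] := Ep_Gp v vC.
  by have [_ ->] := Es_Gs v vC.
rewrite blocks; split.
  apply: uniq_flatten_map => // [v|u v]; rewrite !mem_cs => uC.
    rewrite /block; case: ifP => vj; last by have [] := Es_Gs v uC.
    rewrite /=; have [-> memEp] := Ep_Gp v uC; rewrite andbT memEp.
    apply: contraNN (root_notin_descendants treeT uC) => rv.
    have [||/subsetP/(_ r) + _] := edge_part v [set r; v] => //.
      by rewrite /part /chosen vj.
    by rewrite set21; apply.
  have owner w e : w \in Ch -> e \in block w ->
      (exists2 x, x \in e & x \in descendants T r w) /\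
      {in e, forall x, x = r \/ x \in descendants T r w}.
    move=> wC; rewrite mem_block // => /orP[/andP[_ /eqP->]|/(edge_part w _ wC)].
      have wD := child_descendant treeT wC.
      split; first by exists w; rewrite ?set22.
      by move=> x /set2P[]->; [left | right].
    case=> eD [x xe]; split; first by exists x; rewrite // (subsetP eD).
    by move=> y ye; right; apply: (subsetP eD).
  move=> vC e /(owner u e uC)[[x xe xu] _] /(owner v e vC)[_ /(_ x xe)[xr|xv]].
    by move: xu; rewrite xr (negPf (root_notin_descendants treeT uC)).
  exact: (descendants_disjoint treeT uC vC xu xv).
move=> e; apply/flatten_mapP/(mem_assemble Gs Gp sub_C).
  case=> v; rewrite mem_cs => vC.
  rewrite mem_block // => /orP[/andP[vj /eqP->]|ev].
    by left; exists v.
  by right; exists v.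
case=> [[v vj ->]|[v vC ev]]; exists v; rewrite ?mem_cs //.
- exact: (subsetP sub_C).
- by rewrite mem_block ?(subsetP sub_C) // vj eqxx.
- by rewrite mem_block // /part ev orbT.
Qed.

End RootedTree.
End EdgeLists.

(** * Correctness and running time of the program *)

Section Correctness.
Variables (R : realType) (U : finType) (a : R).
Implicit Types (T : graph U) (r v : U) (C : {set U}) (cs : seq U).

Section PrefixObjective.
Variables (T : graph U) (r : U) (Gs Gp : U -> graph U) (cs : seq U) (d : R).
Notation Ch := (children T r r).
Hypotheses (cs_uniq : uniq cs) (mem_cs : cs =i Ch).
Let fs v := qdso_obj a (Gs v).
Let gp v := aux_obj a v (Gp v).

Lemma set_obj_gain C : C \subset Ch ->
  set_obj a T r d Gs Gp C
  = quad a (#|C|%:R + d) + \sum_(v in Ch) fs v + \sum_(v in C) (gp v - fs v).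
Proof.
move=> CS; rewrite [X in _ = _ + X + _](big_setID C) /= (setIidPr CS) sumrB.
by rewrite /set_obj /fs /gp; ring.
Qed.

Lemma prefix_obj_gain j :
  prefix_obj fs gp a d 0 j cs
  = quad a (j%:R + d) + \sum_(v in Ch) fs v
    + \sum_(v <- take j cs) (gp v - fs v).
Proof.
rewrite -(eq_bigl _ _ mem_cs) -big_uniq //.
rewrite -[X in _ = _ + bigop _ X _ + _](cat_take_drop j).
by rewrite big_cat /= sumrB /prefix_obj add0r; ring.
Qed.

Lemma card_prefix j : (j <= size cs)%N -> #|[set v in take j cs]| = j.
Proof.
by move=> le_j; rewrite cardsE (card_uniqP _) ?take_uniq // size_takel.
Qed.

Lemma prefix_sub j : [set v in take j cs] \subset Ch.
Proof. by apply/subsetP => v; rewrite inE -mem_cs; apply: mem_take. Qed.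

Lemma set_obj_prefix j : (j <= size cs)%N ->
  set_obj a T r d Gs Gp [set v in take j cs] = prefix_obj fs gp a d 0 j cs.
Proof.
move=> le_j; rewrite set_obj_gain ?prefix_sub // card_prefix // prefix_obj_gain.
congr (_ + _); rewrite big_uniq ?take_uniq //=.
by apply: eq_bigl => v; rewrite inE.
Qed.

Lemma set_obj_le_prefix C : sorted (gain_ge fs gp) cs -> C \subset Ch ->
  (#|C| <= size cs)%N /\
  set_obj a T r d Gs Gp C <= prefix_obj fs gp a d 0 #|C| cs.
Proof.
move=> srt CS.
have size_C : #|C| = count [in C] cs.
  rewrite -size_filter -(card_uniqP (filter_uniq _ cs_uniq)).
  apply: eq_card => v; rewrite mem_filter mem_cs andb_idr //.
  exact: (subsetP CS).
split; first by rewrite size_C count_size.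
rewrite set_obj_gain // prefix_obj_gain lerD2l.
have -> : \sum_(v in C) (gp v - fs v) = \sum_(v <- cs | v \in C) (gp v - fs v).
  rewrite -[RHS]big_filter big_uniq ?filter_uniq //; apply: eq_bigl => v.
  by rewrite mem_filter mem_cs andb_idr //; apply: (subsetP CS).
by rewrite size_C; apply: sorted_take_max.
Qed.

Lemma best_prefix_maximizer j : sorted (gain_ge fs gp) cs ->
  is_maximizer (prefix_ok a 0 cs) (fun j => prefix_obj fs gp a d 0 j cs) j ->
  is_maximizer (candidate a T r) (set_obj a T r d Gs Gp) [set v in take j cs].
Proof.
have size_cs : size cs = #|Ch|.
  by rewrite -(card_uniqP cs_uniq); apply: eq_card.
move=> srt [[le_j ok_j] max_j]; split.
  split; first exact: prefix_sub.
  rewrite card_prefix //; case: ok_j => [|->]; first by rewrite add0r; left.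
  by right; rewrite take_size; apply/setP => v; rewrite inE mem_cs.
move=> C [CS okC]; have [le_C le_obj] := set_obj_le_prefix srt CS.
rewrite set_obj_prefix //; apply: le_trans le_obj (max_j _ _); split=> //.
by case: okC => [|->]; [rewrite add0r; left | right].
Qed.

End PrefixObjective.

Definition solve_cost (m : nat) : nat := 1000 * m.+1 ^ 3.

(** The cost [solve_cost m] pays for the work at one vertex apart from the
    recursive calls; the subtrees of the children have one vertex less in total
    than the tree, and the missing one pays for the root. *)
Lemma solve_calls m n T r es :
    (#|vset T| <= n)%N -> rooted_tree T r -> lists_edges es T ->
    (size es <= m)%N ->
  exists (Gs Gp : graph U) (Es Ep : seq (U * U)),
    [/\ uniq (edge_sets Es) /\ edge_sets Es =i eset Gs,
        uniq (edge_sets Ep) /\ edge_sets Ep =i eset Gp,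
        alg_run a T r Gs Gp
      & calls solve_fn (VPair (VName r) (VPair (enc_edges R es) (VNum a)))
          (VPair (VPair (enc_edges R Es) (enc_edges R Ep))
                 (VPair (VNum (qdso_obj a Gs)) (VNum (aux_obj a r Gp))))
          (#|vset T| * solve_cost m)].
Proof.
elim: n T r es => [|n IH] T r es le_n treeT es_T le_m.
  have [_ rT _ _] := treeT; move: le_n; rewrite leqn0 cards_eq0 => /eqP T0.
  by rewrite T0 inE in rT.
set Ch := children T r r.
set incident := fun e : U * U => (e.1 == r) || (e.2 == r).
pose cs := [seq if e.1 == r then e.2 else e.1 | e <- es & incident e].
pose es' := [seq e <- es | ~~ incident e].
have ucs : uniq cs := split_children_uniq r es_T.
have mem_cs : cs =i Ch := split_children treeT es_T.
have le_cs : (size cs <= m)%N := leq_trans (split_size r es) le_m.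
have le_es' : (size es' <= m)%N.
  by apply: leq_trans le_m; rewrite size_filter count_size.
(* The sizes are bounded for every vertex, so that [size_Es] and [size_Ep]
   below hold without restriction; the empty lists serve outside [Ch]. *)
pose kid_ok v (y : (graph U * graph U) * (seq (U * U) * seq (U * U))) :=
  [/\ (size y.2.1 <= m)%N, (size y.2.2 <= m)%N & v \in Ch ->
    [/\ uniq (edge_sets y.2.1) /\ edge_sets y.2.1 =i eset y.1.1,
        uniq (edge_sets y.2.2) /\ edge_sets y.2.2 =i eset y.1.2,
        alg_run a (subtree T r v) v y.1.1 y.1.2
      & calls solve_fn (VPair (VName v) (VPair (enc_edges R es') (VNum a)))
          (VPair (VPair (enc_edges R y.2.1) (enc_edges R y.2.2))
             (VPair (VNum (qdso_obj a y.1.1)) (VNum (aux_obj a v y.1.2))))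
          (#|vset (subtree T r v)| * solve_cost m)]].
have /choice[sol sol_ok] : forall v, exists y, kid_ok v y.
  move=> v; have [vC|vN] := boolP (v \in Ch); last first.
    by exists ((gempty, gempty), ([::], [::])); split=> //; rewrite (negPf vN).
  have treeTv := subtree_rooted treeT vC.
  have es'_Tv : lists_edges es' (subtree T r v) := split_rest treeT es_T vC.
  have [||Gs [Gp [Es [Ep [EsG EpG run_v calls_v]]]]] :=
    IH _ v es' _ treeTv es'_Tv.
  - by rewrite -ltnS; apply: leq_trans le_n; apply: card_subtree.
  - exact: le_es'.
  exists ((Gs, Gp), (Es, Ep)); split=> //=.
  - apply: leq_trans le_es'; rewrite -(size_map (fun e => [set e.1; e.2]) es').
    rewrite -(size_map (fun e => [set e.1; e.2]) Es).
    have [uEs memEs] := EsG; apply: uniq_leq_size => // e.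
    rewrite -/(edge_sets Es) memEs.
    have [[[_ /subsetP sub] _] _] := alg_run_optimal run_v treeTv.
    by move/sub; case: es'_Tv => _ -> /andP[].
  - apply: leq_trans le_es'; rewrite -(size_map (fun e => [set e.1; e.2]) es').
    rewrite -(size_map (fun e => [set e.1; e.2]) Ep).
    have [uEp memEp] := EpG; apply: uniq_leq_size => // e.
    rewrite -/(edge_sets Ep) memEp.
    have [_ [[_ /subsetP sub] _]] := alg_run_optimal run_v treeTv.
    by move/sub; case: es'_Tv => _ -> /andP[].
pose Gs v := (sol v).1.1; pose Gp v := (sol v).1.2.
pose Es v := (sol v).2.1; pose Ep v := (sol v).2.2.
pose fs v := qdso_obj a (Gs v); pose gp v := aux_obj a v (Gp v).
have size_Es v : (size (Es v) <= m)%N by case: (sol_ok v).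
have size_Ep v : (size (Ep v) <= m)%N by case: (sol_ok v).
have run_kid v : v \in Ch -> alg_run a (subtree T r v) v (Gs v) (Gp v).
  by move=> vC; case: (sol_ok v) => _ _ /(_ vC)[].
have EsG : {in Ch, forall v,
    uniq (edge_sets (Es v)) /\ edge_sets (Es v) =i eset (Gs v)}.
  by move=> v vC; case: (sol_ok v) => _ _ /(_ vC)[].
have EpG : {in Ch, forall v,
    uniq (edge_sets (Ep v)) /\ edge_sets (Ep v) =i eset (Gp v)}.
  by move=> v vC; case: (sol_ok v) => _ _ /(_ vC)[].
have sub_s : {in Ch, forall v, spanning_subgraph (Gs v) (subtree T r v)}.
  move=> v vC.
  by have [[]] := alg_run_optimal (run_kid v vC) (subtree_rooted treeT vC).
have sub_p : {in Ch, forall v, spanning_subgraph (Gp v) (subtree T r v)}.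
  move=> v vC.
  by have [_ []] := alg_run_optimal (run_kid v vC) (subtree_rooted treeT vC).
have [t0 le_t0 split] := split_calls R r es.
have [|t1 le_t1 kids] := @kids_calls R U Es Ep fs gp cs
    (VPair (enc_edges R es') (VNum a))
    (fun v => #|vset (subtree T r v)| * solve_cost m)%N.
  by move=> v; rewrite mem_cs => vC; case: (sol_ok v) => _ _ /(_ vC)[].
set L := sort_by_gain fs gp cs in kids.
have perm_L : perm_eq L cs := sort_by_gain_perm fs gp cs.
have uL : uniq L by rewrite (perm_uniq perm_L).
have mem_L : L =i Ch by move=> v; rewrite (perm_mem perm_L) mem_cs.
have srt_L : sorted (gain_ge fs gp) L := sort_by_gain_sorted fs gp cs.
have le_L : (size L <= m)%N by rewrite (perm_size perm_L).
have [j max_j [t2 le_t2 best0]] :=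
  best_calls fs gp size_Es size_Ep r a 0%:R 0 le_L.
have [i max_i [t3 le_t3 best1]] :=
  best_calls fs gp size_Es size_Ep r a 1%:R 0 le_L.
have := best_prefix_maximizer uL mem_L srt_L max_j.
set Cs := [set v in _] => max_Cs.
have := best_prefix_maximizer uL mem_L srt_L max_i.
set Cp := [set v in _] => max_Cp.
have [uEs mem_Es] := prefix_edges_assemble treeT j sub_s sub_p EsG EpG uL mem_L.
have [uEp mem_Ep] := prefix_edges_assemble treeT i sub_s sub_p EsG EpG uL mem_L.
exists (assemble T r Gs Gp Cs), (assemble T r Gs Gp Cp).
exists (prefix_edges Es Ep r j L), (prefix_edges Es Ep r i L); split=> //.
  apply: AlgRun => //.
    by apply: is_maximizer_ext max_Cs => C _; rewrite set_fE.
  by apply: is_maximizer_ext max_Cp => C _; rewrite set_gE.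
have sub_Cs : Cs \subset Ch := prefix_sub mem_L j.
have sub_Cp : Cp \subset Ch := prefix_sub mem_L i.
have -> : qdso_obj a (assemble T r Gs Gp Cs) = prefix_obj fs gp a 0%:R 0 j L.
  rewrite (@qdso_objE _ _ _ r); last first.
    by have [-> _] := assemble_spanning treeT sub_s sub_p sub_Cs; case: treeT.
  rewrite shifted_obj_assemble // set_obj_prefix //.
  by case: max_j => -[].
have -> : aux_obj a r (assemble T r Gs Gp Cp) = prefix_obj fs gp a 1%:R 0 i L.
  rewrite -[LHS]/(shifted_obj a 1 r _) shifted_obj_assemble // set_obj_prefix //.
  by case: max_i => -[].
run.
rewrite (card_vset treeT).
have sum_cs : (\sum_(v <- cs) #|vset (subtree T r v)| * solve_cost m
    = (\sum_(v in Ch) #|vset (subtree T r v)|) * solve_cost m)%N.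
  by rewrite -(eq_bigl _ _ mem_cs) -big_uniq // -big_distrl.
rewrite -/Ch mulSn addnC; move: (\sum_(v in Ch) _)%N sum_cs => S sum_cs.
rewrite {}sum_cs in le_t1.
have M2 : (m.+1 ^ 2 <= m.+1 ^ 3)%N by rewrite leq_pexp2l.
have M1 : (m.+1 <= m.+1 ^ 3)%N by rewrite -{1}[m.+1]expn1 leq_pexp2l.
have le_1 : (t1 <= S * solve_cost m + 100 * m.+1 ^ 2)%N.
  by apply: leq_trans le_t1 _; rewrite leq_add2l leq_mul2l /= leq_exp2r.
have le_best t : (t <= 300 * (size L).+1 * m.+1 ^ 2 -> t <= 300 * m.+1 ^ 3)%N.
  move/leq_trans; apply; rewrite -mulnA leq_mul2l /=.
  by rewrite [X in (_ <= X)%N]expnS leq_mul2r ltnS le_L orbT.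
move: (le_best _ le_t2) (le_best _ le_t3) => {}le_t2 {}le_t3.
rewrite /solve_cost in le_1 *.
clear -M1 M2 le_1 le_t0 le_t2 le_t3 le_m.
move: (m.+1 ^ 3)%N (m.+1 ^ 2)%N M1 M2 le_1 le_t2 le_t3.
by move=> M3 M2 *; lia.
Qed.

End Correctness.

Lemma card_eset (U : finType) (T : graph U) :
  simple_graph T -> (#|eset T| <= #|vset T| ^ 2)%N.
Proof.
move=> sT; rewrite -mulnn -cardsX.
apply: leq_trans (leq_imset_card (fun x => [set x.1; x.2]) _).
apply/subset_leq_card/subsetP => e eT; have [sub e2] := sT _ eT.
move: e2 => /eqP/cards2P[x [y [_ def_e]]].
apply/imsetP; exists (x, y) => //.
by rewrite inE /= !(subsetP sub) // def_e !inE eqxx ?orbT.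
Qed.

Lemma tree_program_executes (R : realType) (U : finType) (T : graph U) (r : U)
    (a : R) :
  rooted_tree T r ->
  executes_within tree_program (#|vset T| * solve_cost (#|vset T| ^ 2) + 60)
    T r a.
Proof.
move=> treeT dT [vs [es [[uvs mem_vs] [ues mem_es] ->]]].
have [sT _ _ _] := treeT.
have size_es : (size es <= #|vset T| ^ 2)%N.
  rewrite -(size_map (fun e => [set e.1; e.2])) -(card_uniqP ues).
  rewrite (eq_card mem_es).
  exact: card_eset.
have [Gs [Gp [Es [Ep [[uEs memEs] [uEp memEp] run_T [t le_t solve]]]]]] :=
  solve_calls a (leqnn _) treeT (lists_all_edges sT ues mem_es) size_es.
have [[[vGs _] _] [[vGp _] _]] := alg_run_optimal run_T treeT.
have [t' le_t' main] : calls main_fn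
    (VPair (VPair (enc_names R vs) (enc_edges R es)) (VPair (VName r) (VNum a)))
    (VPair (VPair (VPair (enc_names R vs) (enc_edges R Es))
                  (VPair (enc_names R vs) (enc_edges R Ep)))
       (VPair (VNum (qdso_obj a Gs)) (VNum (aux_obj a r Gp))))
    (#|vset T| * solve_cost (#|vset T| ^ 2) + 60).
  by run; clear -le_t; move: (_ * solve_cost _)%N le_t; lia.
exists Gs, Gp, (VPair (enc_names R vs) (enc_edges R Es)).
exists (VPair (enc_names R vs) (enc_edges R Ep)), t'; split=> //.
- by exists vs, Es; split=> //; split=> // v; rewrite mem_vs vGs.
- by exists vs, Ep; split=> //; split=> // v; rewrite mem_vs vGp.
Qed.

Theorem theorem7p1 (R : realType) :
  (forall (U : finType) (T : graph U) (r : U) (a : R),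
     rooted_tree T r -> 2 < a ->
     forall Gs Gp : graph U,
       alg_run a T r Gs Gp -> solves_QDSO a T Gs /\ solves_AUX a T r Gp)
  /\
  (exists (P : program) (p : {poly nat}),
     forall (U : finType) (T : graph U) (r : U) (a : R),
       rooted_tree T r -> 2 < a ->
       executes_within P p.[#|vset T|] T r a).
Proof.
split=> [U T r a treeT _ Gs Gp run_T|]; first exact: alg_run_optimal run_T treeT.
exists tree_program,
  ('X * (1000%N%:P * ('X ^+ 2 + 1) ^+ 3) + 60%N%:P) => U T r a treeT _.
rewrite hornerD hornerM hornerM !hornerC hornerX.
rewrite horner_exp hornerD hornerXn hornerC.
by have := tree_program_executes a treeT; rewrite /solve_cost -[(_ ^ 2).+1]addn1.
Qed.
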